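(* For every $\tau\in(0,\infty]$ there exists a topological dynamical system $(X,f)$ satisfying the non-uniform $\tau$-specification property with gap function $M(n,\varepsilon)$ such that: (1) for all sufficiently small $\varepsilon>0$, $\lim_{n\to\infty}\frac{M(n,\varepsilon)}{n}=\tau$; (2) there exist $\psi\in C(X)$ and $0<\gamma<1$ such that $L_\psi=[0,1]$ and, for all $\gamma<a<1$, $R_\psi(a)=\varnothing$ while $$\sup\Big\{h_\mu(f):\mu\in\mathcal{M}_f(X),\ \int_X\psi\,d\mu=a\Big\}>0=h_{top}^B(f,R_\psi(a));$$ consequently the conditional variational principle does not hold for $(X,f)$.
   Context: A topological dynamical system $(X,f)$ consists of a compact metric space $(X,d)$ with at least two points and a continuous map $f:X\to X$. $C(X)$ is the space of real continuous functions on $X$; $\mathcal{M}_f(X)$ is the set of $f$-invariant Borel probability measures; $h_\mu(f)$ is measure-theoretic entropy. Non-uniform specification: $(X,f)$ has the non-uniform specification property with gap function $M:\mathbb{N}\times(0,\infty)\to\mathbb{N}$ ($\mathbb{N}$ the positive integers) if $M(n,\varepsilon)$ is non-decreasing in $n$ and non-increasing in $\varepsilon$, and for every $\varepsilon>0$, every integer $k\ge2$, all $x_1,\dots,x_k\in X$ and all non-negative integers $a_1\le b_1<a_2\le b_2<\cdots<a_k\le b_k$ with $a_{i+1}-b_i\ge M(b_i-a_i+1,\varepsilon)$ for $1\le i\le k-1$, there is $z\in X$ with $d(f^{n-a_i}x_i,f^nz)\le\varepsilon$ for all $a_i\le n\le b_i$, $1\le i\le k$. Let $\mathscr{G}(X,f)$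 be the set of all such gap functions for $(X,f)$ and $\tau(M)=\sup_{\varepsilon>0}\liminf_{n\to\infty}M(n,\varepsilon)/n\in[0,\infty]$. $(X,f)$ has the non-uniform $\tau$-specification property if there is $M\in\mathscr{G}(X,f)$ with $\tau(M)=\tau$ and every $M'\in\mathscr{G}(X,f)$ satisfies $\tau(M')\ge\tau$; ''with gap function $M$'' means $M\in\mathscr{G}(X,f)$. Level sets: for $\varphi\in C(X)$, $L_\varphi=\big[\inf_{\mu\in\mathcal{M}_f(X)}\int\varphi\,d\mu,\ \sup_{\mu\in\mathcal{M}_f(X)}\int\varphi\,d\mu\big]$, and for $a\in L_\varphi$, $R_\varphi(a)=\{x\in X:\lim_{n\to\infty}\frac1n\sum_{i=0}^{n-1}\varphi(f^ix)=a\}$. The conditional variational principle holds for $(X,f)$ if $h_{top}^B(f,R_\varphi(a))=\sup\{h_\mu(f):\mu\in\mathcal{M}_f(X),\int\varphi\,d\mu=a\}$ for every $\varphi\in C(X)$ with $\mathrm{Int}(L_\varphi)\ne\varnothing$ and every $a\in\mathrm{Int}(L_\varphi)$. Bowen topological entropy of $F\subset X$: let $B_n(x,\varepsilon)=\{y:\max_{0\le i\le n-1}d(f^ix,f^iy)<\varepsilon\}$. For $t\ge0$ let $C(F;t,N,\varepsilon,f)$ be the infimum of $\sum_k e^{-tn_k}$ over finite or countable covers $\{B_{n_k}(x_k,\varepsilon)\}$ of $F$ with $x_k\in F$, $n_k\ge N$; let $C(F;t,\varepsilon,f)=\lim_{N\to\infty}C(F;t,N,\varepsilon,f)$, $h_{top}^B(F;\varepsilon,f)=\inf\{t\ge0:C(F;t,\varepsilon,f)=0\}$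 and $h_{top}^B(f,F)=\lim_{\varepsilon\to0}h_{top}^B(F;\varepsilon,f)$; in particular $h_{top}^B(f,\varnothing)=0$. *)

(* Defs.v *)
From HB Require Import structures.
From mathcomp Require Import all_boot all_order all_algebra.
From mathcomp Require Import all_classical all_reals all_analysis.

Set Implicit Arguments.
Unset Strict Implicit.
Unset Printing Implicit Defensive.

Import Order.TTheory GRing.Theory Num.Theory.
Import numFieldNormedType.Exports.

Local Open Scope classical_set_scope.
Local Open Scope ring_scope.

(* The library's measurable types are pointed. Since a dynamical system has at
   least two points, choosing a point is harmless; nothing below uses it. *)
#[short(type="pointedMetricType")]
HB.structure Definition PointedMetric (K : numDomainType) :=
  { M of Metric K M & isPointed M }.

Definition is_tds (R : realType) (X : pointedMetricType R) (f : X -> X) : Prop :=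
  [/\ compact [set: X], (exists x y : X, x <> y) & continuous f].

Section Specification.
Context {R : realType} {X : pointedMetricType R}.

(* Only the values M n e with 0 < n and 0 < e are meaningful, and all the
   conditions below bear on these values only. *)
Definition monotone_gap (M : nat -> R -> nat) : Prop :=
  [/\ forall n e, (0 < n)%N -> 0 < e -> (0 < M n e)%N,
      forall m n e, (0 < m)%N -> (m <= n)%N -> 0 < e -> (M m e <= M n e)%N
    & forall n e e', (0 < n)%N -> 0 < e -> e <= e' -> (M n e' <= M n e)%N].

Definition specification (f : X -> X) (M : nat -> R -> nat) : Prop :=
  forall (e : R) (k : nat) (x : 'I_k -> X) (a b : 'I_k -> nat),
    0 < e -> (2 <= k)%N ->
    (forall i, (a i <= b i)%N) ->
    (forall i j : 'I_k, j = i.+1 :> nat ->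
       (b i < a j)%N /\ (M (b i - a i + 1)%N e <= a j - b i)%N) ->
    exists z : X, forall (i : 'I_k) (n : nat), (a i <= n <= b i)%N ->
      mdist (iter (n - a i) f (x i)) (iter n f z) <= e.

Definition gap_functions (f : X -> X) : set (nat -> R -> nat) :=
  [set M | monotone_gap M /\ specification f M].

(* M(n, e) / n; the term of index 0 has no influence on limits. *)
Definition gap_ratio (M : nat -> R -> nat) (e : R) (n : nat) : \bar R :=
  ((M n e)%:R / n%:R)%:E.

Definition gap_rate (M : nat -> R -> nat) : \bar R :=
  ereal_sup [set limn_einf (gap_ratio M e) | e in [set e : R | 0 < e]].

Definition nonuniform_tau_specification (f : X -> X) (tau : \bar R) : Prop :=
  (exists2 M, gap_functions f M & gap_rate M = tau) /\
  (forall M', gap_functions f M' -> (tau <= gap_rate M')%E).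

End Specification.

Notation borel X := (g_sigma_algebraType (@open X)).

Section MeasureEntropy.
Context {R : realType} {X : pointedMetricType R}.

Definition invariant_measures (f : X -> X) : set (probability (borel X) R) :=
  [set mu | forall A : set (borel X), measurable A -> mu (f @^-1` A) = mu A].

(* Cells may be empty; they do not contribute to the entropy. *)
Definition measurable_partition (k : nat) (A : 'I_k -> set (borel X)) : Prop :=
  [/\ forall i, measurable (A i), trivIset setT A & \bigcup_i A i = setT].

Definition join_cell (f : X -> X) (k : nat) (A : 'I_k -> set (borel X))
    (n : nat) (w : {ffun 'I_n -> 'I_k}) : set (borel X) :=
  [set x | forall i : 'I_n, A (w i) (iter i f x)].

(* The convention 0 * ln 0 = 0 holds since ln 0 = 0. *)
Definition join_entropy (mu : probability (borel X) R) (f : X -> X)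
    (k : nat) (A : 'I_k -> set (borel X)) (n : nat) : R :=
  - \sum_(w : {ffun 'I_n -> 'I_k})
      fine (mu (join_cell f A w)) * ln (fine (mu (join_cell f A w))).

Definition partition_entropy (mu : probability (borel X) R) (f : X -> X)
    (k : nat) (A : 'I_k -> set (borel X)) : R :=
  limn (fun n => join_entropy mu f A n / n%:R).

Definition measure_entropy (mu : probability (borel X) R) (f : X -> X) : \bar R :=
  ereal_sup [set h | exists (k : nat) (A : 'I_k -> set (borel X)),
    measurable_partition A /\ h = (partition_entropy mu f A)%:E].

End MeasureEntropy.

Section BowenEntropy.
Context {R : realType} {X : pointedMetricType R}.

Definition bowen_ball (f : X -> X) (n : nat) (x : X) (e : R) : set X :=
  [set y | \big[Num.max/0]_(i < n) mdist (iter i f x) (iter i f y) < e].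

(* Finite or countable families are indexed by an arbitrary set I of naturals. *)
Definition bowen_cover (f : X -> X) (F : set X) (N : nat) (e : R)
    (I : set nat) (x : nat -> X) (n : nat -> nat) : Prop :=
  (forall k, I k -> F (x k) /\ (N <= n k)%N) /\
  F `<=` \bigcup_(k in I) bowen_ball f (n k) (x k) e.

Definition bowen_sum (f : X -> X) (F : set X) (t : R) (N : nat) (e : R) : \bar R :=
  ereal_inf [set s | exists (I : set nat) (x : nat -> X) (n : nat -> nat),
    bowen_cover f F N e I x n /\
    s = (\esum_(k in I) (expR (- (t * (n k)%:R)))%:E)%E].

Definition bowen_measure (f : X -> X) (F : set X) (t e : R) : \bar R :=
  limn (fun N => bowen_sum f F t N e).

Definition bowen_entropy_at (f : X -> X) (F : set X) (e : R) : \bar R :=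
  ereal_inf [set t%:E | t in [set t : R | 0 <= t /\ bowen_measure f F t e = 0%E]].

Definition bowen_entropy (f : X -> X) (F : set X) : \bar R :=
  lim (bowen_entropy_at f F e @[e --> 0^'+]).

End BowenEntropy.

Section LevelSets.
Context {R : realType} {X : pointedMetricType R}.

Definition space_average (mu : probability (borel X) R) (phi : X -> R) : R :=
  (\int[mu]_(x in [set: borel X]) (phi x : R))%R.

Definition average_range (f : X -> X) (phi : X -> R) : set R :=
  let S := [set space_average mu phi | mu in invariant_measures f] in
  `[inf S, sup S]%classic.

Definition level_set (f : X -> X) (phi : X -> R) (a : R) : set X :=
  [set x | (n%:R^-1 * \sum_(i < n) phi (iter i f x)) @[n --> \oo] --> a].

Definition constrained_entropy (f : X -> X) (phi : X -> R) (a : R) : \bar R :=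
  ereal_sup [set measure_entropy mu f |
    mu in [set mu | invariant_measures f mu /\ space_average mu phi = a]].

Definition conditional_variational_principle (f : X -> X) : Prop :=
  forall phi : X -> R, continuous phi ->
    (average_range f phi)° !=set0 ->
    forall a, (average_range f phi)° a ->
      bowen_entropy f (level_set f phi a) = constrained_entropy f phi a.

End LevelSets.

(* Main.v *)
From HB Require Import structures.
Require Import Defs.
From mathcomp Require Import all_boot all_order all_algebra.
From mathcomp Require Import all_classical all_reals all_analysis.
From mathcomp Require Import measurable_realfun zify lra ring.
Import Order.TTheory GRing.Theory Num.Theory.
Import numFieldNormedType.Exports.
Local Open Scope classical_set_scope.
Local Open Scope ring_scope.

Set Implicit Arguments.
Unset Strict Implicit.
Unset Printing Implicit Defensive.

(* Fix a non-decreasing g with g n / n --> tau and g n >= c n for some c > 0.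
   The system is the one-sided subshift over {None, Some true, Some false} in
   which a block of n symbols None, once ended, is followed by no further None
   within the next g n positions; psi is the indicator of None at time 0.

   A gap slightly longer than g lets one glue orbit segments by inserting free
   symbols. Conversely, shadowing n symbols None and then the word (Some, None)
   forces a gap of length at least g n, so that tau is optimal.

   A point that is not eventually None has infinitely many prefixes in which the
   frequency of None is at most 1 / (1 + c), so no point has a frequency of None
   in ]1 / (1 + c), 1[. Nevertheless, the mixture of the point mass at None^oo,
   with weight a, and of the Bernoulli measure on {Some true, Some false}^N has
   integral a and entropy (1 - a) ln 2 > 0. The Bernoulli measure is the law of
   the binary digits of a uniform point of [0, 1[. *)

(** * The subshift *)

Section FirstDifference.
Context {R : realType} {T : eqType}.
Implicit Types x y z : nat -> T.

Definition agree n x y := forall i, (i < n)%N -> x i = y i.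

(** With value [1/(n+1)] at first difference [n], the closed ball of radius [1/(n+1)] consists of
    the sequences sharing the first [n] symbols. *)
Definition seq_dist x y : R :=
  if pselect (exists n, x n != y n) is left e then (ex_minn e).+1%:R^-1 else 0.

Lemma seq_dist_leP n x y : seq_dist x y <= n.+1%:R^-1 <-> agree n x y.
Proof.
rewrite /seq_dist; case: pselect => [e|ne]; last first.
  by rewrite invr_ge0 ler0n; split=> // _ i _; apply: contra_notP ne => /eqP; exists i.
case: ex_minnP => m xym mmin; rewrite lef_pV2 ?posrE ?ltr0n// ler_nat ltnS.
split=> [nm i ilt|xy]; last by rewrite leqNgt; apply: contra xym => /xy ->.
by apply/eqP; apply: contraTT ilt => /mmin mi; rewrite -leqNgt (leq_trans nm).
Qed.

Lemma seq_dist_val x y :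
  (seq_dist x y = 0 /\ x = y) \/ exists n, seq_dist x y = n.+1%:R^-1.
Proof.
rewrite /seq_dist; case: pselect => [e|ne]; first by right; eexists.
by left; split=> //; apply/funext => i; apply: contra_notP ne => /eqP; exists i.
Qed.

Lemma seq_dist_refl x : seq_dist x x = 0.
Proof. by rewrite /seq_dist; case: pselect => // e; case: (ex_minnP e) => n /eqP. Qed.

Lemma seq_dist_eq0 x y : seq_dist x y = 0 -> x = y.
Proof.
case: (seq_dist_val x y) => [[]//|[n ->] /eqP].
by rewrite invr_eq0 pnatr_eq0.
Qed.

Lemma seq_dist_sym x y : seq_dist x y = seq_dist y x.
Proof.
suff le u v : seq_dist u v <= seq_dist v u by apply/eqP; rewrite eq_le !le.
case: (seq_dist_val v u) => [[-> ->]|[n vu]]; first by rewrite seq_dist_refl.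
rewrite vu; apply/seq_dist_leP => i ilt.
by have /seq_dist_leP -> : seq_dist v u <= n.+1%:R^-1 by rewrite vu.
Qed.

Lemma seq_dist_ge0 x y : 0 <= seq_dist x y.
Proof. by case: (seq_dist_val x y) => [[->]|[n ->]]; rewrite ?invr_ge0 ?ler0n. Qed.

Lemma seq_dist_triangle y x z : seq_dist x z <= seq_dist x y + seq_dist y z.
Proof.
(* The stronger ultrametric inequality holds: two agreements chain up to the shorter of their
   lengths. *)
suff: seq_dist x z <= Num.max (seq_dist x y) (seq_dist y z).
  by move/le_trans; apply; rewrite ge_max lerDl lerDr !seq_dist_ge0.
case: (seq_dist_val x y) => [[-> ->]|[n xy]]; first by rewrite le_max lexx orbT.
case: (seq_dist_val y z) => [[-> <-]|[m yz]]; first by rewrite le_max lexx.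
rewrite xy yz; wlog nm : x z n m xy yz / (n <= m)%N => [W|].
  case: (leqP n m) => [|/ltnW] nm; first exact: W.
  by rewrite seq_dist_sym maxC; apply: W => //; rewrite seq_dist_sym.
rewrite le_max; apply/orP; left; apply/seq_dist_leP => i ilt.
have /seq_dist_leP -> : seq_dist x y <= n.+1%:R^-1 by rewrite xy.
have /seq_dist_leP -> : seq_dist y z <= m.+1%:R^-1 by rewrite yz.
all: rewrite //; exact: leq_trans nm.
Qed.

End FirstDifference.

(* [None] is the symbol counted by the observable, and a block of [n] of them
   must be followed by at least [g n] symbols among the free ones [Some _]
   before [None] may occur again. *)
Definition admissible (g : nat -> nat) (x : nat -> option bool) : Prop :=
  forall i m j, (i < m)%N -> (forall k, (i <= k < m)%N -> x k = None) ->
    x m != None -> (m < j)%N -> x j = None -> (m + g (m - i) <= j)%N.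

(** Each instance of admissibility reads only the symbols up to [j], so it passes to limits;
    compactness rests on this closedness. *)
Lemma admissible_agree g x :
  (forall n, exists2 y, admissible g y & agree n x y) -> admissible g x.
Proof.
move=> xP i m j im run xm mj xj; have [y yP xy] := xP j.+1.
apply: (yP i m j) => //; last by rewrite -xy.
- by move=> k /andP[ik km]; rewrite -xy ?run ?ik//; lia.
- by rewrite -xy//; lia.
Qed.

Lemma admissible_free g (b : nat -> bool) : admissible g (fun n => Some (b n)).
Proof. by []. Qed.

Lemma admissible_None g : admissible g (fun=> None).
Proof. by []. Qed.

Lemma admissible_shift g x : admissible g x -> admissible g (fun n => x n.+1).
Proof.
move=> xP i m j im run xm mj xj.
rewrite -ltnS -addSn -subSS; apply: xP => // k km.
by case: k km => // k km; apply: run.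
Qed.

(** The parameter [R] records in the type the field of values of the metric, so that the metric can
    be inferred from the type. *)
Definition gapshift (R : realType) (g : nat -> nat) : Type :=
  {x : nat -> option bool | admissible g x}.

Section GapShift.
Context {R : realType} {g : nat -> nat}.
Local Notation X := (gapshift R g).

Definition digits (x : X) : nat -> option bool := sval x.

Lemma digits_inj : injective digits.
Proof. by move=> [x Px] [y Py] /= xy; apply: eq_exist. Qed.

HB.instance Definition _ := gen_eqMixin X.
HB.instance Definition _ := gen_choiceMixin X.

Let mdist (x y : X) : R := seq_dist (digits x) (digits y).

Let mdist_eq0 x y : mdist x y = 0 -> x = y.
Proof. by move/seq_dist_eq0/digits_inj. Qed.

HB.instance Definition _ := isMetric.Build R X
  (fun x => seq_dist_refl (digits x)) mdist_eq0
  (fun x y => seq_dist_sym (digits x) (digits y))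
  (fun y x z => seq_dist_triangle (digits y) (digits x) (digits z)).

Definition all_None : X := exist _ _ (@admissible_None g).
Definition all_Some (b : nat -> bool) : X := exist _ _ (@admissible_free g b).

HB.instance Definition _ := isPointed.Build X all_None.

Definition shift_map (x : X) : X := exist _ _ (admissible_shift (svalP x)).

Lemma digits_iter n x i : digits (iter n shift_map x) i = digits x (i + n)%N.
Proof. by elim: n x => [|n IH] x; rewrite ?addn0// iterSr IH addnS. Qed.

End GapShift.

(** * Topology and Borel sets *)

Section GapShiftTopology.
Context {R : realType} {g : nat -> nat}.
Local Notation X := (gapshift R g).

Lemma mdist_leP n (x y : X) :
  mdist x y <= n.+1%:R^-1 <-> agree n (digits x) (digits y).
Proof. exact: seq_dist_leP. Qed.

Lemma nbhs_agreeP (x : X) (A : set X) :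
  nbhs x A <-> exists n, [set y | agree n (digits x) (digits y)] `<=` A.
Proof.
rewrite -nbhs_ballE; split=> [[e /= e0 eA]|[n nA]].
  exists (Num.truncn e^-1) => y /mdist_leP xy; apply: eA; rewrite ballEmdist /=.
  apply: le_lt_trans xy _; rewrite -[e in _ < e]invrK ltf_pV2 ?posrE ?ltr0n ?invr_gt0//.
  by rewrite truncnS_gt.
exists n.+1%:R^-1 => /=; first by rewrite invr_gt0 ltr0n.
by move=> y; rewrite ballEmdist => /= /ltW/mdist_leP/nA.
Qed.

Lemma continuous_gapshiftP (U : topologicalType) (h : X -> U) :
  (forall x, exists n, forall y, agree n (digits x) (digits y) -> h y = h x) ->
  continuous h.
Proof.
move=> hloc x A /= Ax; apply/nbhs_agreeP; have [n nP] := hloc x.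
by exists n => y /nP xy; rewrite /= xy; exact: nbhs_singleton.
Qed.

Lemma continuous_shift_map : continuous (shift_map : X -> X).
Proof.
move=> x A /= /nbhs_agreeP[n nA]; apply/nbhs_agreeP; exists n.+1 => y xy.
by apply: nA => i ilt /=; exact: xy.
Qed.

(** An ultrafilter selects one of the three symbols at each coordinate. The selected sequence [s] is
    its limit, and is admissible because each of its prefixes is a prefix of some point. *)
Lemma compact_gapshift : compact [set: X].
Proof.
rewrite compact_ultra => F FU _.
have digitP i : exists s, F [set x : X | digits x i = s].
  have := @filterT _ F _; have -> : [set: X] = [set x | digits x i = None] `|`
     ([set x | digits x i = Some true] `|` [set x | digits x i = Some false]).
    by apply/seteqP; split=> // x _ /=; case: (digits x i) => [[]|]; tauto.
  have dec A : F A \/ F (~` A) by exact: in_ultra_setVsetC.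
  have [?|NF1] := dec [set x : X | digits x i = None]; first by eexists; eassumption.
  have [?|NF2] := dec [set x : X | digits x i = Some true]; first by eexists; eassumption.
  move=> _; exists (Some false).
  by apply: filterS (filterI NF1 NF2) => x [] /=; case: (digits x i) => [[]|].
pose s i := projT1 (cid (digitP i)).
have sF n : F [set x : X | agree n s (digits x)].
  elim: n => [|n IHn]; first by apply: filterS (@filterT _ F _).
  apply: filterS (filterI IHn (projT2 (cid (digitP n)))) => x [xs xn] i.
  by rewrite ltnS leq_eqVlt => /predU1P[->|/xs//]; exact: esym.
have sP : admissible g s.
  apply: admissible_agree => n; have [x sx] := filter_ex (sF n).
  by exists (digits x); first exact: (svalP x).
exists (exist _ s sP : X); split=> // A /nbhs_agreeP[n nA].
exact: filterS nA (sF n).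
Qed.

Lemma gapshift_tds : is_tds (shift_map : X -> X).
Proof.
split; [exact: compact_gapshift| |exact: continuous_shift_map].
exists all_None, (all_Some xpredT) => /(congr1 (fun x : X => digits x 0%N)).
by [].
Qed.

Definition cylinder (w : seq (option bool)) : set X :=
  [set x | agree (size w) (nth None w) (digits x)].

(** Two cylinders are nested or disjoint; adding the empty set makes the family a pi-system. *)
Definition cylinders : set (set (borel X)) := set0 |` range cylinder.

Lemma setI_closed_cylinders : setI_closed cylinders.
Proof.
have I0 w w' : (size w <= size w')%N -> cylinders (cylinder w `&` cylinder w').
  move=> sw; have [ww'|nww'] := pselect (agree (size w) (nth None w) (nth None w')).
    right; exists w' => //; apply/seteqP; split=> [x xw'|x []//]; split=> // i ilt.
    by rewrite ww'//; apply: xw'; apply: leq_trans sw.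
  left; rewrite /= -subset0 => x [xw xw']; apply: nww' => i ilt.
  by rewrite xw// xw'//; apply: leq_trans sw.
move=> _ _ [->|[w _ <-]] [->|[w' _ <-]]; rewrite ?setI0 ?set0I; try by left.
by have [/I0//|/ltnW/I0] := leqP (size w) (size w'); rewrite setIC.
Qed.

Lemma open_cylinder w : open (cylinder w).
Proof.
rewrite openE => x xw; apply/nbhs_agreeP; exists (size w) => y xy i ilt.
by rewrite -xy// xw.
Qed.

Lemma open_bigcup_cylinder (A : set X) :
  open A -> A = \bigcup_(w in [set w | cylinder w `<=` A]) cylinder w.
Proof.
rewrite openE => Ao; apply/seteqP; split=> [x /Ao /nbhs_agreeP[n nA]|x [w wA]]; last exact: wA.
have agreeE (y : X) : cylinder (mkseq (digits x) n) y <-> agree n (digits x) (digits y).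
  rewrite /cylinder /= size_mkseq.
  by split=> h i ilt; have := h i ilt; rewrite nth_mkseq.
exists (mkseq (digits x) n); last exact/agreeE.
by move=> y /agreeE; apply: nA.
Qed.

(** There are countably many words, so an open set is a countable union of cylinders. *)
Lemma borel_cylinders : (@measurable _ (borel X)) = <<s cylinders >>.
Proof.
apply/seteqP; split; apply: smallest_sub; try exact: smallest_sigma_algebra.
  move=> A /= /open_bigcup_cylinder ->.
  rewrite bigcup_mkcond.
  apply: (@countable_bigcupT_measurable _ (g_sigma_algebraType cylinders)) => // w.
  by case: ifP => // _; apply: sub_sigma_algebra; right; exists w.
move=> _ [->|[w _ <-]]; first exact: measurable0.
by apply: sub_sigma_algebra; exact: open_cylinder.
Qed.

Lemma measurable_cylinder w : measurable (cylinder w : set (borel X)).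
Proof. by rewrite borel_cylinders; apply: sub_sigma_algebra; right; exists w. Qed.

Lemma measurable_digit i (B : set (option bool)) :
  measurable ([set x | B (digits x i)] : set (borel X)).
Proof.
apply: sub_sigma_algebra; rewrite /= openE => x Bx; apply/nbhs_agreeP.
by exists i.+1 => y xy; rewrite /= -xy.
Qed.

Lemma measurable_shift_map : measurable_fun setT (shift_map : borel X -> borel X).
Proof.
apply: (@measurability _ _ (borel X) (borel X) setT _ (@open X) (erefl _)).
move=> _ [A Ao <-]; rewrite setTI.
by apply: sub_sigma_algebra; apply: open_comp => // x _; exact: continuous_shift_map.
Qed.

Lemma eq_cylinder_measure (mu nu : {finite_measure set (borel X) -> \bar R}) :
  (forall w, mu (cylinder w) = nu (cylinder w)) ->
  forall A, measurable A -> mu A = nu A.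
Proof.
move=> munu; apply: (@measure_unique _ _ _ cylinders (fun=> setT)) => //.
- exact: borel_cylinders.
- exact: setI_closed_cylinders.
- by move=> _; right; exists [::] => //; apply/seteqP; split.
- by apply/seteqP; split=> // x _; exists 0%N.
- by move=> A0 [->|[w _ <-]]; [rewrite !measure0|exact: munu].
- by move=> _; rewrite ltey_eq fin_num_measure.
Qed.

End GapShiftTopology.

(** * Specification *)

Section Specification.
Context {R : realType} {g : nat -> nat}.
Hypothesis g_homo : {homo g : m n / (m <= n)%N}.
Local Notation X := (gapshift R g).

Definition precision (e : R) : nat := (Num.truncn e^-1).+1.

(** Shadowing with precision [p] also prescribes symbols after the last time of a segment: [p.+1]
    makes room for them and for a free symbol, and [g (n + p)] dominates the gap due after any block
    of [None] among the prescribed symbols. *)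
Definition gap_bound (n : nat) (e : R) : nat :=
  ((precision e).+1 + g (n + precision e))%N.

Lemma agree_precision (e : R) (x y : X) :
  0 < e -> agree (precision e) (digits x) (digits y) -> mdist x y <= e.
Proof.
move=> e0 xy; have /mdist_leP/le_trans : agree (Num.truncn e^-1) (digits x) (digits y).
  by move=> i ilt; apply: xy; exact: ltnW.
apply; rewrite -[e in _ <= e]invrK lef_pV2 ?posrE ?ltr0n ?invr_gt0//.
by apply: ltW; rewrite truncnS_gt.
Qed.

Lemma monotone_gap_bound : monotone_gap gap_bound.
Proof.
split=> [//|m n e _ mn _|n e e' _ e0 ee'].
  by rewrite leq_add2l g_homo// leq_add2r.
have pe : (precision e' <= precision e)%N.
  by rewrite ltnS le_truncn// lef_pV2// posrE// (lt_le_trans e0).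
by rewrite leq_add// g_homo// leq_add2l.
Qed.

(* Outside the prescribed blocks the orbit is filled with free symbols. *)
Lemma specification_gap_bound : specification (shift_map : X -> X) gap_bound.
Proof.
move=> e k x a b e0 _ ab gap; set p := precision e.
(* The hypothesis separates consecutive segments only; induction on [j] extends it to all pairs. *)
have gap_lt (i j : 'I_k) : (i < j)%N ->
    (b i + p.+1 + g (b i - a i + 1 + p) <= a j)%N.
  case: j => j jk /= ij; elim: j jk ij => // j IHj jk.
  rewrite ltnS leq_eqVlt => /predU1P[ij|ij].
    have [/= _] := gap i (Ordinal jk) (congr1 S (esym ij)).
    by rewrite /gap_bound -/p; have := ab i; lia.
  have jk' : (j < k)%N by lia.
  have [/= ? ?] := gap (Ordinal jk') (Ordinal jk) erefl.
  by have := IHj jk' ij; have := ab (Ordinal jk'); lia.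
pose inblock (n : nat) (i : 'I_k) := (a i <= n < b i + p)%N.
have inblock_inj n i j : inblock n i -> inblock n j -> i = j.
  rewrite /inblock => ni nj; apply/val_inj => /=.
  by case: (ltngtP i j) => // /gap_lt; lia.
pose z n : option bool :=
  if [pick i | inblock n i] is Some i then digits (x i) (n - a i)%N else Some true.
have zE n i : inblock n i -> z n = digits (x i) (n - a i)%N.
  by rewrite /z => ni; case: pickP => [j /inblock_inj/(_ ni) -> //|/(_ i)]; rewrite ni.
have zNone n : z n = None -> exists i, inblock n i.
  by rewrite /z; case: pickP => // i ni _; exists i.
have zP : admissible g z.
  move=> s m t sm run zm mt zt.
  have [i si] : exists i, inblock s i by apply/zNone/run; rewrite leqnn.
  (* A run of [None] stays in one block, since distinct blocks are separated by at least one free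
     symbol. *)
  have blk u : (s <= u < m)%N -> inblock u i.
    elim: u => [|u IHu] su; first by have -> : 0%N = s by lia.
    have [<-//|neq] := eqVneq s u.+1.
    have ui : inblock u i by apply: IHu; lia.
    have [j uj] := zNone _ (run _ su).
    have [ij|ij|/val_inj ->//] := ltngtP (i : nat) j.
      by have := gap_lt _ _ ij; rewrite /inblock in ui uj; lia.
    by have := gap_lt _ _ ij; rewrite /inblock in ui uj; have := ab i; lia.
  have [j tj] := zNone _ zt.
  have m1 : inblock m.-1 i by apply: blk; lia.
  have [ij|ij|/val_inj ij] := ltngtP (i : nat) j.
  - have := gap_lt _ _ ij; have : (g (m - s) <= g (b i - a i + 1 + p))%N.
      by apply: g_homo; rewrite /inblock in si m1; lia.
    by rewrite /inblock in m1 tj; lia.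
  - by have := gap_lt _ _ ij; have := ab i; rewrite /inblock in m1 tj; lia.
  (* When run and later [None] lie in the same block, the constraint is that of [x i], translated by
     [a i]. *)
  subst j; have mi : inblock m i by rewrite /inblock in m1 tj *; lia.
  have := svalP (x i) (s - a i)%N (m - a i)%N (t - a i)%N.
  have -> : (m - a i - (s - a i) = m - s)%N by rewrite /inblock in si; lia.
  rewrite -[sval _]/(digits (x i)) -!zE//.
  move=> H; have /H : (s - a i < m - a i)%N by rewrite /inblock in si; lia.
  move=> {}H; suff /H/(_ zm) : forall k0 : nat, (s - a i <= k0 < m - a i)%N ->
      digits (x i) k0 = None.
    by move=> {}H; have := H _ zt; rewrite /inblock in si mi; lia.
  move=> u su; have -> : (u = u + a i - a i)%N by lia.
  rewrite -zE; first by apply: run; rewrite /inblock in si; lia.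
  by apply: blk; rewrite /inblock in si; lia.
exists (exist _ z zP : X) => i n nab; apply: agree_precision => // j jp.
rewrite !digits_iter /= (zE _ i); last by rewrite /inblock -/p; lia.
by congr (digits _ _); lia.
Qed.

Lemma gap_functions_gap_bound : gap_functions (shift_map : X -> X) gap_bound.
Proof. by split; [exact: monotone_gap_bound|exact: specification_gap_bound]. Qed.

(* Any orbit following [None] [n] times and then a free symbol and [None] must
   respect the gap [g] of its possibly prolonged initial block of [None]. *)
Lemma gap_functions_ge (M : nat -> R -> nat) n :
  gap_functions (shift_map : X -> X) M -> (0 < n)%N -> (g n <= M n 2^-1)%N.
Proof.
move=> [[M0 _ _] Mspec] n0; set m := M n _.
have m0 : (0 < m)%N by apply: M0; rewrite ?invr_gt0.
have yP : admissible g (fun i => if i == 1%N then None else Some true).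
  move=> i l j il run; case: eqP => // l1 _ lj; case: eqP => // j1.
  by have := run i; case: eqP => //; lia.
(* Precision [1/2] fixes exactly one symbol per time. The segments prescribe [None] at times [0] to
   [n - 1], then [Some true] and [None] at times [n - 1 + m] and [n + m], with a gap of exactly
   [m]. *)
pose x (i : 'I_2) : X := if i == 0 then all_None else exist _ _ yP.
pose a (i : 'I_2) : nat := if i == 0 then 0%N else (n.-1 + m)%N.
pose b (i : 'I_2) : nat := if i == 0 then n.-1 else (n + m)%N.
have [] := Mspec 2^-1 2%N x a b; rewrite ?invr_gt0//.
- by move=> i; rewrite /a /b; case: ifP => _ //; lia.
- case=> -[|[|i]] ilt // [[|[|j]] jlt] //= _; rewrite /a /b /=.
  have -> : (n.-1 - 0 + 1 = n)%N by lia.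
  by rewrite -/m; split; lia.
move=> z zP.
have zE (i : 'I_2) l : (a i <= l <= b i)%N -> digits z l = digits (x i) (l - a i)%N.
  by move=> /zP/(@mdist_leP R g 1)/(_ 0%N erefl); rewrite !digits_iter.
have zNone l : (l < n)%N -> digits z l = None.
  by move=> ln; rewrite (zE 0)// /a /b /=; lia.
have zSome : digits z (n.-1 + m)%N = Some true.
  by rewrite (zE 1)// /a /b /= ?subnn//; lia.
have zlast : digits z (n + m)%N = None.
  rewrite (zE 1); last by rewrite /a /b /=; lia.
  by rewrite /x /a /=; have -> : (n + m - (n.-1 + m) = 1)%N by lia.
(* The first free symbol of [z], at [l], ends a block of length [l >= n]. Then [l + g l <= n + m]
   gives [g n <= g l <= m]. *)
have ex : exists l, digits z l != None by exists (n.-1 + m)%N; rewrite zSome.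
have [l zl lmin] := ex_minnP ex.
have nl : (n <= l)%N by rewrite leqNgt; apply: contra zl => /zNone ->.
have lm : (l <= n.-1 + m)%N by apply: lmin; rewrite zSome.
have := svalP z 0 l (n + m)%N; rewrite subn0 => /(_ _ _ zl _ zlast) H.
have : (l + g l <= n + m)%N.
  apply: H; [by lia| |by lia] => u /andP[_ ul]; apply/eqP.
  by apply: contraTT ul => /lmin; rewrite leqNgt.
by have := g_homo nl; lia.
Qed.

End Specification.

(** * Growth rate of the gap *)

Lemma cvg_natV {R : realType} : (n%:R^-1 : R) @[n --> \oo] --> (0 : R).
Proof. by rewrite -cvg_shiftS; exact: cvg_harmonic. Qed.

Section Rates.
Context {R : realType} {g : nat -> nat} {tau : \bar R}.
Hypothesis g_homo : {homo g : m n / (m <= n)%N}.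
Hypothesis g_cvg : (((g n)%:R / n%:R : R)%:E @[n --> \oo] --> tau)%E.
Local Notation X := (gapshift R g).

(** The ratio equals [u n + w n * v n] for [n > 0], where [w] is a shift of [g n / n], [u] tends to
    [0] and [v] to [1]. Limits are taken in the extended reals because [tau] may be infinite. *)
Lemma cvg_gap_ratio (e : R) : gap_ratio (gap_bound (g := g)) e n @[n --> \oo] --> tau.
Proof.
set p := precision e.
pose u n : R := (p.+1%:R * n%:R^-1).
pose v n : R := 1 + p%:R * n%:R^-1.
pose w n : \bar R := ((g (n + p)%N)%:R / (n + p)%:R)%:E.
have uE : ((u n)%:E @[n --> \oo] --> 0%E)%E.
  apply: cvg_EFin; first exact: nearW.
  by rewrite -[X in _ --> X](mulr0 p.+1%:R); apply: cvgMr; exact: cvg_natV.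
have vE : ((v n)%:E @[n --> \oo] --> 1%E)%E.
  apply: cvg_EFin; first exact: nearW.
  rewrite -[X in _ --> X]addr0; apply: cvgD; first exact: cvg_cst.
  by rewrite -[X in _ --> X](mulr0 p%:R); apply: cvgMr; exact: cvg_natV.
have wE : w n @[n --> \oo] --> tau.
  by move: g_cvg; rewrite -(cvg_shiftn p).
rewrite -[tau]add0e -[X in (0 + X)%E]mule1.
have H : ((u n)%:E + w n * (v n)%:E)%E @[n --> \oo] --> (0 + tau * 1)%E.
  apply: cvgeD => //; apply: cvgeM => //.
  by rewrite mule_defE onee_eq0 /= orbF negb_and orbT.
apply: cvg_trans H; apply: near_eq_cvg; near=> n.
have n0 : (n%:R : R) != 0 by rewrite pnatr_eq0 -lt0n; near: n; exists 1%N.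
rewrite /gap_ratio /gap_bound -/p /u /v /w -EFinM -EFinD; congr EFin.
rewrite [in RHS]natrD [RHS]mulrDl natrD; congr (_ + _).
by field; rewrite n0 /= -natrD pnatr_eq0 -lt0n addn_gt0 lt0n -(pnatr_eq0 R) n0.
Unshelve. all: by end_near. Qed.

Lemma gap_rate_gap_bound : gap_rate (gap_bound (R := R) (g := g)) = tau.
Proof.
rewrite /gap_rate [X in ereal_sup X](_ : _ = [set tau]) ?ereal_sup1//.
apply/seteqP; split=> [_ [e _ <-]|_ ->] /=.
  by have [->] := cvg_limn_einf_sup (cvg_gap_ratio e).
by exists 1 => /=; first exact: ltr01; have [->] := cvg_limn_einf_sup (cvg_gap_ratio 1).
Qed.

(** The rate is a supremum over precisions, so the bound [g n <= M n 2^-1] at the single precision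
    [1/2] suffices. *)
Lemma gap_rate_ge (M : nat -> R -> nat) :
  gap_functions (shift_map : X -> X) M -> (tau <= gap_rate M)%E.
Proof.
move=> MP; apply: ereal_sup_ge; eexists; first by exists 2^-1 => //=; rewrite invr_gt0.
have [<- _] := cvg_limn_einf_sup g_cvg; rewrite !limn_einf_lim.
apply: lee_lim; [exact/is_cvg_einfs|exact/is_cvg_einfs|apply: nearW => n].
apply: le_ereal_inf_tmp => _ [m /= nm <-].
apply: (@le_trans _ _ ((g m)%:R / m%:R)%:E); first by apply: ereal_inf_lbound; exists m.
(* At index [0] both ratios are [0], the inverse of [0] being [0]. *)
rewrite lee_fin; case: m {nm} => [|m]; first by rewrite invr0 !mulr0.
by rewrite ler_pM2r ?invr_gt0 ?ltr0n// ler_nat; exact: (gap_functions_ge g_homo MP).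
Qed.

Lemma gapshift_tau_specification :
  nonuniform_tau_specification (shift_map : X -> X) tau.
Proof.
split; last exact: gap_rate_ge.
by exists (gap_bound (g := g)); [exact: gap_functions_gap_bound|exact: gap_rate_gap_bound].
Qed.

End Rates.

(** For finite [tau = r], an integer within [1] above [r * n] works, with [c = r]; for infinite
    [tau], the square [n ^ 2] works, with [c = 1]. *)
Lemma exists_gap {R : realType} (tau : \bar R) : (0 < tau)%E ->
  exists g : nat -> nat, [/\ {homo g : m n / (m <= n)%N},
    (((g n)%:R / n%:R : R)%:E @[n --> \oo] --> tau)%E &
    exists2 c : R, 0 < c & forall n, c * n%:R <= (g n)%:R].
Proof.
case: tau => [r| |] //; rewrite ?lte_fin => r0.
- exists (fun n => (Num.truncn (r * n%:R)).+1); split.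
  + by move=> m n mn; rewrite ltnS le_truncn// ler_pM2l// ler_nat.
  + apply: cvg_EFin; first exact: nearW.
    have rn n : 0 <= r * n%:R by rewrite mulr_ge0// ltW.
    apply: (@squeeze_cvgr _ _ _ _ (fun=> r) (fun n => r + n%:R^-1)).
    * near=> n; have n0 : (0 : R) < n%:R by rewrite ltr0n; near: n; exists 1%N.
      rewrite ler_pdivlMr// (ltW (truncnS_gt _)) /=.
      rewrite -addn1 natrD mulrDl mul1r lerD2r ler_pdivrMr// truncn_le.
      exact: rn.
    * exact: cvg_cst.
    * rewrite -[X in _ --> X]addr0; apply: cvgD; [exact: cvg_cst|exact: cvg_natV].
  + by exists r => // n; rewrite ltW// truncnS_gt.
- exists (fun n => n ^ 2)%N; split.
  + by move=> m n mn; rewrite leq_sqr.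
  + apply/cvgeryP; apply: cvg_trans (@cvgr_idn R); apply: near_eq_cvg; near=> n.
    have n0 : (n%:R : R) != 0 by rewrite pnatr_eq0 -lt0n; near: n; exists 1%N.
    by rewrite natrX expr2 mulfK.
  + exists 1 => // n; rewrite mul1r ler_nat; case: n => // n.
    by rewrite expnS expn1 leq_pmulr.
Unshelve. all: by end_near. Qed.

(** * Invariant measures *)

Section Mixture.
Context d (T : measurableType d) (R : realType).
Variables (P Q : probability T R) (s : R) (s01 : 0 <= s <= 1).

Let s_ge0 : 0 <= s. Proof. by case/andP: s01. Qed.
Let s_le1 : 0 <= 1 - s. Proof. by rewrite subr_ge0; case/andP: s01. Qed.

Definition mixture : set T -> \bar R :=
  measure_add (mscale (NngNum s_ge0) P) (mscale (NngNum s_le1) Q).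

HB.instance Definition _ := Measure.on mixture.

Lemma mixtureE A : mixture A = (s%:E * P A + (1 - s)%:E * Q A)%E.
Proof. by rewrite /mixture measure_addE. Qed.

Let mixture_setT : mixture setT = 1%E.
Proof. by rewrite mixtureE !probability_setT !mule1 -EFinD addrC subrK. Qed.

HB.instance Definition _ := Measure_isProbability.Build _ _ _ mixture mixture_setT.

End Mixture.

(** * Binary digits and dyadic intervals *)

Section BinaryDigits.
Context {R : realType}.
Implicit Type t : R.

Definition doubling t : R := if t < 2^-1 then 2 * t else 2 * t - 1.

Definition binary t : nat -> bool := fun n => 2^-1 <= iter n doubling t.

Lemma binaryS t n : binary t n.+1 = binary (doubling t) n.
Proof. by rewrite /binary iterSr. Qed.

(** The number [0.w] in base two: the left end of the interval of points whose binary expansion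
    starts with [w]. *)
Fixpoint dyadic (w : seq bool) : R :=
  if w is b :: w' then (b%:R + dyadic w') / 2 else 0.

Lemma dyadic_ge0 w : 0 <= dyadic w.
Proof. by elim: w => //= b w IH; rewrite divr_ge0// addr_ge0. Qed.

Lemma dyadic_le1 w : dyadic w + 2^-1 ^+ size w <= 1.
Proof.
elim: w => [|b w IH] /=; first by rewrite expr0 add0r.
rewrite exprS; suff: (b%:R : R) <= 1 by lra.
by rewrite lern1 leq_b1.
Qed.

(** By induction on [w]: [doubling] maps each half of [[0, 1[] affinely onto [[0, 1[] and drops the
    first digit. *)
Lemma agree_binary w t : 0 <= t < 1 ->
  agree (size w) (nth false w) (binary t) <->
  dyadic w <= t < dyadic w + 2^-1 ^+ size w.
Proof.
elim: w t => [|b w IH] t t01 /=.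
  by rewrite expr0 add0r t01; split=> // _ i.
have t01' : 0 <= doubling t < 1 by rewrite /doubling; case: ltP; lra.
have -> : agree (size w).+1 (nth false (b :: w)) (binary t) <->
    b = binary t 0%N /\ agree (size w) (nth false w) (binary (doubling t)).
  split=> [h|[b0 h] [_|i /h]]; rewrite ?binaryS//.
  by split=> [|i ilt]; [exact: (h 0%N)|rewrite -binaryS -h].
rewrite IH// /binary /doubling /= exprS; have := dyadic_ge0 w; have := dyadic_le1 w.
set u := dyadic w; set v := _ ^+ _; move=> uv u0.
have v0 : 0 < v by rewrite exprn_gt0// invr_gt0.
case: ltP => t2; split.
- by move=> [-> /=]; lra.
- by case: b => /=; [lra|split=> //; lra].
- by move=> [-> /=]; lra.
- by case: b => /=; [split=> //; lra|lra].
Qed.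

Lemma measurable_doubling : measurable_fun setT doubling.
Proof.
apply: measurable_fun_ifT => /=.
- exact: measurable_fun_ltr.
- exact: measurable_funM.
- by apply: measurable_funB => //; exact: measurable_funM.
Qed.

Lemma measurable_binary n (B : set bool) : measurable [set t : R | B (binary t n)].
Proof.
have it : measurable_fun setT (iter n doubling : R -> R).
  elim: n => [|n IH]; first exact: measurable_id.
  exact: (measurableT_comp measurable_doubling IH).
have mb : measurable_fun setT (fun t : R => binary t n) by exact: measurable_fun_ler.
by have := mb measurableT B; rewrite setTI; apply.
Qed.

Definition unit_lebesgue : set (measurableTypeR R) -> \bar R :=
  mrestr lebesgue_measure (measurable_itv `[0 : R, 1[).

HB.instance Definition _ := Measure.copy unit_lebesgue
  (mrestr lebesgue_measure (measurable_itv `[0 : R, 1[)).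

Let unit_lebesgue_setT : unit_lebesgue setT = 1%E.
Proof.
by rewrite /unit_lebesgue /mrestr setTI lebesgue_measure_itv /= lte_fin ltr01 oppr0 adde0.
Qed.

HB.instance Definition _ :=
  Measure_isProbability.Build _ _ _ unit_lebesgue unit_lebesgue_setT.

Lemma unit_lebesgue_binary w :
  unit_lebesgue [set t | agree (size w) (nth false w) (binary t)] =
  (2^-1 ^+ size w)%:E.
Proof.
rewrite /unit_lebesgue /mrestr.
rewrite (_ : _ `&` _ = `[dyadic w, dyadic w + 2^-1 ^+ size w[%classic).
  rewrite lebesgue_measure_itv /= lte_fin ltrDl exprn_gt0 ?invr_gt0//.
  by rewrite -EFinB addrC addKr.
apply/seteqP; split=> t /=; rewrite !in_itv /=.
  by move=> [tw t01]; apply/agree_binary.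
move=> tw; have t01 : 0 <= t < 1.
  by have := dyadic_ge0 w; have := dyadic_le1 w; move/andP: tw => []; lra.
by split=> //; apply/agree_binary.
Qed.

End BinaryDigits.

(** * The Bernoulli measure and its mixture with a point mass *)

Section FreeMeasure.
Context {R : realType} {g : nat -> nat}.
Local Notation X := (gapshift R g).

Definition free_point (t : measurableTypeR R) : borel X := all_Some (binary t).

Let measurable_free_point : measurable_fun setT free_point.
Proof.
apply: (@measurability _ _ (measurableTypeR R) (borel X) setT _ cylinders borel_cylinders).
move=> _ [_ [->|[w _ <-]] <-]; rewrite setTI ?preimage_set0//.
have -> : free_point @^-1` cylinder w = \bigcap_(i in `I_(size w))
    [set t : R | nth None w i = Some (binary t i)] by [].
apply: bigcap_measurableType => i _.
exact: (measurable_binary i [set b | nth None w i = Some b]).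
Qed.

HB.instance Definition _ :=
  isMeasurableFun.Build _ _ _ _ free_point measurable_free_point.

HB.instance Definition _ :=
  isMeasurableFun.Build _ _ _ _ (shift_map : borel X -> borel X) measurable_shift_map.

Definition free_measure : probability (borel X) R :=
  distribution unit_lebesgue free_point.

Lemma free_measure_cylinder w : free_measure (cylinder w) =
  if None \in w then 0%E else (2^-1 ^+ size w)%:E.
Proof.
rewrite /free_measure /= /distribution /pushforward.
case: ifPn => [/(nthP None)[i ilt wi]|Nw].
  rewrite (_ : _ @^-1` _ = set0) ?measure0// -subset0 => t /(_ i ilt).
  by rewrite wi.
pose v := map (odflt false) w.
have -> : 2^-1 ^+ size w = 2^-1 ^+ size v :> R by rewrite size_map.
have wv i : (i < size w)%N -> nth None w i = Some (nth false v i).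
  move=> ilt; rewrite (nth_map None)//.
  by case: nth (mem_nth None ilt) => // Nin; rewrite Nin in Nw.
rewrite -unit_lebesgue_binary; congr (unit_lebesgue _).
apply/seteqP; split=> t /= tw i; rewrite ?size_map => ilt.
  by have := tw i ilt; rewrite wv//= => -[].
by rewrite wv// tw// size_map.
Qed.

(** It suffices to test cylinders. The preimage of the cylinder of [w] splits according to the
    symbol put in front of [w]: [None] gives mass [0], and each free symbol gives half the mass of
    [w]. *)
Lemma invariant_free_measure :
  invariant_measures (shift_map : X -> X) free_measure.
Proof.
move=> A mA.
pose P : probability _ _ := distribution free_measure (shift_map : borel X -> borel X).
apply: (@eq_cylinder_measure R g P free_measure) => // w.
change (free_measure ((shift_map : X -> X) @^-1` cylinder w) = free_measure (cylinder w)).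
pose C s : set (borel X) := cylinder (s :: w).
have mC s : measurable (C s) by exact: measurable_cylinder.
have CI s s' : s != s' -> C s `&` C s' = set0.
  move=> ss'; rewrite -subset0 => x [/(_ 0%N erefl) /= xs /(_ 0%N erefl) /= xs'].
  by move: ss'; rewrite xs xs' eqxx.
have -> : (shift_map : X -> X) @^-1` cylinder w = C None `|` (C (Some true) `|` C (Some false)).
  apply/seteqP; split=> [x xw|x xw i ilt].
    have: C (digits x 0%N) x by case=> [|i] //= ilt; exact: xw.
    by case: (digits x 0%N) => [[]|]; [right; left|right; right|left].
  by case: xw => [|[|]] => /(_ i.+1 ilt).
transitivity (free_measure (C None) +
    (free_measure (C (Some true)) + free_measure (C (Some false))))%E.
  rewrite measureU; [|exact: mC|by apply: measurableU; exact: mC|].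
    by rewrite measureU; [|exact: mC|exact: mC|exact: CI].
  by rewrite setIUr !CI// setU0.
rewrite !free_measure_cylinder !in_cons /=; case: ifP => _; first by rewrite !adde0.
by rewrite add0e -EFinD exprS; congr EFin; lra.
Qed.

Variables (s : R) (s01 : 0 <= s <= 1).

Definition frozen_free : probability (borel X) R :=
  mixture (dirac (all_None : borel X)) free_measure s01.

Lemma frozen_freeE A : frozen_free A =
  (s%:E * dirac (all_None : borel X) A + (1 - s)%:E * free_measure A)%E.
Proof. exact: mixtureE. Qed.

Lemma invariant_frozen_free : invariant_measures (shift_map : X -> X) frozen_free.
Proof.
move=> A mA; rewrite !frozen_freeE invariant_free_measure//.
congr (_ * _ + _)%E; rewrite !diracE; congr (_%:R%:E).
have fix_None : shift_map all_None = all_None :> X by exact: digits_inj.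
by congr nat_of_bool; apply/idP/idP; rewrite !inE /= fix_None.
Qed.

(** The empty word is excluded: it is both constantly [None] and free of [None], and its cylinder
    has mass [1], not [s]. *)
Lemma frozen_free_cylinder w : (0 < size w)%N -> frozen_free (cylinder w) =
  (if w == nseq (size w) None then s
   else if None \in w then 0 else (1 - s) * 2^-1 ^+ size w)%:E.
Proof.
move=> w0; rewrite frozen_freeE free_measure_cylinder diracE.
have -> : ((all_None : borel X) \in (cylinder w : set (borel X))) = (w == nseq (size w) None).
  apply/idP/eqP; rewrite inE; [move=> wN|move=> ->]; last first.
    by move=> i; rewrite size_nseq => ilt; rewrite nth_nseq ilt.
  apply: (@eq_from_nth _ None); rewrite ?size_nseq// => i ilt.
  by rewrite wN// nth_nseq ilt.
case: eqP => [->|_]; first by rewrite mem_nseq w0 /= mule0 mule1 adde0.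
by case: ifP => _; rewrite ?mule0 add0e.
Qed.

End FreeMeasure.

(** * Entropy and integrals *)

Section Entropy.
Context {R : realType} {g : nat -> nat}.
Local Notation X := (gapshift R g).
Local Notation K := #|{: option bool}|.

Definition digit_cell (i : 'I_K) : set (borel X) :=
  [set x | digits x 0%N = enum_val i].

Lemma measurable_partition_digit_cell : measurable_partition digit_cell.
Proof.
split=> [i||]; first exact: (measurable_digit 0 [set s | s = enum_val i]).
  apply/trivIsetP => i j _ _ ij; rewrite -subset0 /digit_cell => x /= [-> /enum_val_inj].
  by move/eqP; rewrite (negbTE ij).
apply/seteqP; split=> // x _; exists (enum_rank (digits (x : X) 0%N)) => //=.
by rewrite /digit_cell /= enum_rankK.
Qed.

Let word n (w : {ffun 'I_n -> 'I_K}) : seq (option bool) :=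
  [seq enum_val (w i) | i <- enum 'I_n].

Let size_word n (w : {ffun 'I_n -> 'I_K}) : size (word w) = n.
Proof. by rewrite size_map size_enum_ord. Qed.

Let nth_word n (w : {ffun 'I_n -> 'I_K}) (i : 'I_n) : nth None (word w) i = enum_val (w i).
Proof. by rewrite (nth_map i) ?size_enum_ord// nth_ord_enum. Qed.

Let join_cell_word n (w : {ffun 'I_n -> 'I_K}) :
  join_cell (shift_map : X -> X) digit_cell w = cylinder (word w).
Proof.
apply/seteqP; split=> x xw i.
  rewrite size_word => ilt; have := xw (Ordinal ilt).
  by rewrite /digit_cell /= digits_iter add0n => ->; rewrite -nth_word.
have := xw i; rewrite size_word => /(_ (ltn_ord i)).
by rewrite nth_word /digit_cell /= digits_iter add0n => ->.
Qed.

Variables (s : R) (s0 : 0 < s) (s1 : s < 1) (s01 : 0 <= s <= 1).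
Local Notation mu := (frozen_free (g := g) s01).

(** The word [None^n] has mass [s], the [2 ^ n] words without [None] have mass [c] each, and all
    others are null. The result is [n * (1 - s) * ln 2] plus the entropy of the weights [s] and
    [1 - s]. *)
Lemma join_entropy_frozen_free n : (0 < n)%N ->
  join_entropy mu (shift_map : X -> X) digit_cell n =
  n%:R * ((1 - s) * ln 2) - (s * ln s + (1 - s) * ln (1 - s)).
Proof.
move=> n0; pose rN : 'I_K := enum_rank None; pose wN : {ffun 'I_n -> 'I_K} := [ffun=> rN].
pose c : R := (1 - s) * 2^-1 ^+ n.
have muE w : fine (mu (join_cell (shift_map : X -> X) digit_cell w)) =
    if w == wN then s else if w \in ffun_on (predC1 rN) then c else 0.
  rewrite join_cell_word frozen_free_cylinder ?size_word//= .
  have -> : (word w == nseq n None) = (w == wN).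
    apply/eqP/eqP => [wE|->]; last first.
      apply: (@eq_from_nth _ None); rewrite size_word ?size_nseq// => i ilt.
      by rewrite (nth_word _ (Ordinal ilt)) ffunE enum_rankK nth_nseq ilt.
    apply/ffunP => i; rewrite ffunE; apply: enum_val_inj.
    by rewrite -nth_word wE nth_nseq ltn_ord enum_rankK.
  case: eqP => // _; have -> : (None \in word w) = ~~ (w \in ffun_on (predC1 rN)).
    apply/idP/idP => [/(nthP None)[i]|].
      rewrite size_word => ilt; rewrite (nth_word _ (Ordinal ilt)) => wi.
      apply/negP => /ffun_onP/(_ (Ordinal ilt)); rewrite inE /=.
      by rewrite -[w _]enum_valK wi eqxx.
    apply: contraR => Nw; apply/ffun_onP => i; rewrite inE /=.
    apply: contra Nw => /eqP wi; apply/(nthP None); exists i; rewrite ?size_word//.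
    by rewrite nth_word wi enum_rankK.
  by case: (w \in _).
have wNon : wN \notin ffun_on (predC1 rN).
  by apply/negP => /ffun_onP/(_ (Ordinal n0)); rewrite ffunE inE /= eqxx.
rewrite /join_entropy (bigD1 wN)//= muE eqxx.
rewrite (eq_bigr (fun w => if w \in ffun_on (predC1 rN) then c * ln c else 0)); last first.
  by move=> w /negbTE wwN; rewrite muE wwN; case: ifP => // _; rewrite mul0r.
rewrite -big_mkcondr /= (eq_bigl (mem (ffun_on (predC1 rN)))); last first.
  by move=> w /=; apply: andb_idl => won; apply: contraNneq wNon => <-.
rewrite sumr_const card_ffun_on cardC1 !card_ord card_option card_bool /=.
have two0 : (2 : R) != 0 by rewrite pnatr_eq0.
have cE : c *+ 2 ^ n = 1 - s.
  by rewrite /c -mulrnAr exprVn -mulr_natl natrX mulfV ?mulr1// expf_neq0.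
rewrite -mulrnAl cE /c lnM ?posrE ?subr_gt0 ?exprn_gt0 ?invr_gt0//.
by rewrite lnXn ?invr_gt0// lnV ?posrE// -mulr_natl; ring.
Qed.

Lemma partition_entropy_frozen_free :
  partition_entropy mu (shift_map : X -> X) digit_cell = (1 - s) * ln 2.
Proof.
pose h := s * ln s + (1 - s) * ln (1 - s).
apply/cvg_lim => //.
have H : ((1 - s) * ln 2 - h * n%:R^-1) @[n --> \oo] --> (1 - s) * ln 2 - h * 0.
  by apply: cvgB; [exact: cvg_cst|apply: cvgMr; exact: cvg_natV].
rewrite mulr0 subr0 in H; apply: cvg_trans H; apply: near_eq_cvg; near=> n.
have n0 : (0 < n)%N by near: n; exists 1%N.
rewrite join_entropy_frozen_free// -/h [RHS]mulrBl [in RHS]mulrAC mulfV ?mul1r//.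
by rewrite pnatr_eq0 -lt0n.
Unshelve. all: by end_near. Qed.

Lemma measure_entropy_frozen_free_gt0 :
  (0 < measure_entropy mu (shift_map : X -> X))%E.
Proof.
apply: (@lt_le_trans _ _ ((1 - s) * ln 2)%:E).
  by rewrite lte_fin mulr_gt0 ?subr_gt0// ln_gt0// ltr1n.
apply: ereal_sup_ubound; exists K, digit_cell.
by split; [exact: measurable_partition_digit_cell|rewrite partition_entropy_frozen_free].
Qed.

End Entropy.

(** * The indicator of [None] and its integrals *)

Section Observable.
Context {R : realType} {g : nat -> nat}.
Local Notation X := (gapshift R g).

Definition is_None (x : X) : R := (digits x 0%N == None)%:R.

Lemma continuous_is_None : continuous is_None.
Proof.
by apply: continuous_gapshiftP => x; exists 1%N => y xy; rewrite /is_None xy.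
Qed.

Lemma space_average_is_None (mu : probability (borel X) R) :
  space_average mu is_None = fine (mu (cylinder [:: None])).
Proof.
rewrite /space_average /Rintegral; congr fine.
rewrite -[cylinder _]setIT -integral_indic//; last exact: measurable_cylinder.
apply: eq_integral => x _; congr EFin; rewrite indicE /is_None; congr ((nat_of_bool _)%:R).
apply/eqP/idP => [x0|]; first by rewrite inE; case.
by rewrite inE => /(_ 0%N erefl).
Qed.

Lemma space_average_frozen_free (s : R) (s01 : 0 <= s <= 1) :
  space_average (frozen_free s01) is_None = s.
Proof. by rewrite space_average_is_None frozen_free_cylinder. Qed.

(** Integrals of [is_None] are masses of a cylinder, hence lie in [[0, 1]]; the mixtures of weights
    [0] and [1] attain both ends. *)
Lemma average_range_is_None :
  average_range (shift_map : X -> X) is_None = `[0, 1]%classic.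
Proof.
rewrite /average_range; set S := (X in inf X).
have S01 : S `<=` `[0, 1]%classic.
  move=> _ [mu _ <-]; rewrite space_average_is_None /= in_itv /=.
  have mC : measurable (cylinder [:: None] : set (borel X)) by exact: measurable_cylinder.
  by rewrite fine_ge0//= -lee_fin fineK ?fin_num_measure// probability_le1.
have memS (s : R) : 0 <= s <= 1 -> S s.
  move=> s01; exists (frozen_free s01); last exact: space_average_frozen_free.
  exact: invariant_frozen_free.
have S0 : S 0 by apply: memS; rewrite lexx ler01.
have S1 : S 1 by apply: memS; rewrite lexx ler01.
have lb0 : lbound S 0 by move=> y /S01; rewrite /= in_itv => /andP[].
have ub1 : ubound S 1 by move=> y /S01; rewrite /= in_itv => /andP[].
have -> : inf S = 0.
  apply/eqP; rewrite eq_le; apply/andP; split; last by apply: lb_le_inf => //; exists 0.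
  by apply: ge_inf => //; exists 0.
have -> // : sup S = 1.
apply/eqP; rewrite eq_le; apply/andP; split; first by apply: ge_sup => //; exists 0.
by apply: ub_le_sup => //; exists 1.
Qed.

Lemma constrained_entropy_is_None_gt0 (s : R) : 0 < s < 1 ->
  (0 < constrained_entropy (shift_map : X -> X) is_None s)%E.
Proof.
move=> /andP[s0 s1]; have s01 : 0 <= s <= 1 by rewrite !ltW.
apply: (@lt_le_trans _ _ (measure_entropy (frozen_free s01) (shift_map : X -> X))).
  exact: measure_entropy_frozen_free_gt0.
apply: ereal_sup_ubound; exists (frozen_free s01) => //.
by split; [exact: invariant_frozen_free|exact: space_average_frozen_free].
Qed.

End Observable.

(** The empty family covers the empty set at no cost, already for [t = 0]. *)
Lemma bowen_entropy_set0 (R : realType) (X : pointedMetricType R) (f : X -> X) :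
  bowen_entropy f set0 = 0%E.
Proof.
have sum0 t N e : bowen_sum f set0 t N e = 0%E.
  apply/eqP; rewrite eq_le; apply/andP; split.
    apply: ereal_inf_lbound; exists set0, (fun=> point), (fun=> 0%N).
    by rewrite esum_set0; split=> //; split.
  apply: le_ereal_inf_tmp => _ [I [x [n [_ ->]]]].
  by apply: esum_ge0 => k _; rewrite lee_fin expR_ge0.
have at0 e : bowen_entropy_at f set0 e = 0%E.
  have m0 t : bowen_measure f set0 t e = 0%E.
    by rewrite /bowen_measure; under eq_fun do rewrite sum0; exact: lim_cst.
  apply/eqP; rewrite eq_le; apply/andP; split.
    by apply: ereal_inf_lbound; exists 0 => //=.
  by apply: le_ereal_inf_tmp => _ [t [t0 _] <-]; rewrite lee_fin.
by rewrite /bowen_entropy; under eq_fun do rewrite at0; exact: lim_cst.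
Qed.

(** * Frequency of None along orbits *)

Section Frequency.
Context {R : realType} {g : nat -> nat} {c : R}.
Hypothesis c_gt0 : 0 < c.
Hypothesis g_ge : forall n, c * n%:R <= (g n)%:R.
Implicit Type x : nat -> option bool.

Definition ones x n : nat := (\sum_(i < n) (x i == None))%N.

Lemma onesS x n : ones x n.+1 = (ones x n + (x n == None))%N.
Proof. exact: big_ord_recr. Qed.

(** The frequency bound [1 / (1 + c)], multiplied out so that the empty prefix satisfies it and can
    start inductions. *)
Definition sparse x n : Prop := (1 + c) * (ones x n)%:R <= n%:R.

(** The block and its gap occupy at least [(1 + c) * (m - i)] positions but contribute only [m - i]
    symbols [None], so the bound passes from [i] to [n]. *)
Lemma sparse_gap x i m n : admissible g x -> (i <= m < n)%N ->
  (forall k, (i <= k < m)%N -> x k = None) -> x m != None ->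
  ones x n = (ones x i + (m - i))%N -> sparse x i -> x n = None -> sparse x n.
Proof.
move=> xP /andP[im mn] run xm onesE sp xn.
rewrite /sparse onesE natrD mulrDr.
have gap : i%:R + ((m - i)%:R + c * (m - i)%:R) <= n%:R :> R.
  have [mi|mi] := leqP m i.
    have -> : (m - i = 0)%N by lia.
    by rewrite mulr0 !addr0 ler_nat; lia.
  have := xP i m n mi run xm mn xn; rewrite -(ler_nat R); apply: le_trans.
  by rewrite addrA -natrD subnKC// natrD lerD2l.
apply: le_trans gap; apply: lerD; first exact: sp.
by rewrite mulrDl mul1r.
Qed.

(* The prefix of length [n] is a sparse prefix of length [i] followed by [None]
   up to position [n], or up to some earlier position [m] where the block of
   [None] ended and after which none has occurred yet. *)
Lemma sparse_prefix x n : admissible g x ->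
  (exists i, [/\ (i <= n)%N, forall k, (i <= k < n)%N -> x k = None,
      ones x n = (ones x i + (n - i))%N & sparse x i]) \/
  (exists i m, [/\ (i <= m < n)%N, forall k, (i <= k < m)%N -> x k = None,
      x m != None, ones x n = (ones x i + (m - i))%N & sparse x i]).
Proof.
move=> xP; elim: n => [|n [[i [ilt run onesE sp]]|[i [m [/andP[im mn] run xm onesE sp]]]]].
- left; exists 0%N; split=> //; first by lia.
  by rewrite /sparse /ones big_ord0 mulr0.
- have [xn|xn] := eqVneq (x n) None.
  + left; exists i; split=> //; [by lia| |by rewrite onesS xn eqxx onesE; lia].
    move=> k ikn; have [->//|kn] := eqVneq k n; apply: run; lia.
  + right; exists i, n; split=> //; first by lia.
    by rewrite onesS (negbTE xn) addn0.
- have [xn|xn] := eqVneq (x n) None; last first.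
    right; exists i, m; split=> //; first by lia.
    by rewrite onesS (negbTE xn) addn0.
  (* A [None] reappears after the gap: the prefix of length [n] is sparse by [sparse_gap], and a new
     block starts at [n]. *)
  left; exists n; split; [by lia| |by rewrite onesS xn eqxx; lia|].
    by move=> k kn; have -> : k = n by lia.
  by apply: (@sparse_gap x i m n) => //; lia.
Qed.

Lemma frequently_sparse x : admissible g x ->
  (exists N, forall n, (N <= n)%N -> x n = None) \/
  (forall N, exists2 n, (N <= n)%N & (0 < n)%N /\ sparse x n).
Proof.
move=> xP; have [|nevt] := pselect (exists N, forall n, (N <= n)%N -> x n = None).
  by left.
right=> N; apply: contrapT => nsp.
have {}nsp n : (N < n)%N -> ~ sparse x n.
  by move=> Nn sp; apply: nsp; exists n => //; [lia|split=> //; lia].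
(* Assume no prefix longer than [N] is sparse. After a free symbol at [n0 > N], a further [None]
   would yield such a prefix, by [sparse_prefix]; so none occurs, the count stays constant, and long
   prefixes become sparse after all. *)
have [n0 Nn0 xn0] : exists2 n0, (N < n0)%N & x n0 != None.
  apply: contrapT => H; apply: nevt; exists N.+1 => n Nn.
  by apply/eqP; apply: contrapT => /negP xn; apply: H; exists n.
have xn n : (n0 <= n)%N -> x n != None.
  rewrite leq_eqVlt => /predU1P[<-//|n0n]; apply/eqP => xnN.
  have [[i [ilt run _ sp]]|[i [m [imn run xm onesE sp]]]] := sparse_prefix n xP.
    have [i0|i0] := leqP i n0; last by apply: nsp sp; lia.
    by move/eqP: xn0; apply; apply: run; lia.
  by apply: (nsp n); [lia|exact: (sparse_gap xP imn run)].
have ones_cst k : ones x (n0 + k) = ones x n0.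
  elim: k => [|k IH]; first by rewrite addn0.
  by rewrite addnS onesS IH (negbTE (xn _ _)) ?addn0// leq_addr.
pose k := (Num.truncn ((1 + c) * (ones x n0)%:R)).+1.
apply: (nsp (n0 + k)%N); first by lia.
rewrite /sparse ones_cst natrD ltW// (lt_le_trans (truncnS_gt _))//.
by rewrite lerDr.
Qed.

Local Notation X := (gapshift R g).

Lemma ergodic_sum_is_None (x : X) n :
  \sum_(i < n) is_None (iter i shift_map x) = (ones (digits x) n)%:R.
Proof.
rewrite /ones natr_sum; apply: eq_bigr => i _.
by rewrite /is_None digits_iter add0n.
Qed.

(** A point that is eventually [None] has averages tending to [1]. Any other point has averages at
    most [(1 + c)^-1] at arbitrarily large times, so they cannot converge to [a]. *)
Lemma level_set_is_None (a : R) : (1 + c)^-1 < a < 1 ->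
  level_set (shift_map : X -> X) is_None a = set0.
Proof.
move=> /andP[ca a1]; rewrite -subset0 => x /= xa.
have {}xa : n%:R^-1 * (ones (digits x) n)%:R @[n --> \oo] --> a.
  by rewrite /level_set /= in xa; under eq_fun do rewrite -ergodic_sum_is_None.
have [[N xN]|freq] := frequently_sparse (svalP x).
  have ones_ge n : (n <= ones (digits x) n + N)%N.
    elim: n => // n IH; rewrite onesS.
    have [Nn|nN] := leqP N n; last by lia.
    by rewrite [digits x n]xN// eqxx; lia.
  suff : 1 <= a by rewrite leNgt a1.
  have lim1 : (1 - N%:R * n%:R^-1 : R) @[n --> \oo] --> (1 - N%:R * 0 : R).
    by apply: cvgB; [exact: cvg_cst|apply: cvgMr; exact: cvg_natV].
  rewrite mulr0 subr0 in lim1; apply: ler_cvg_to lim1 xa _; near=> n.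
  have n0 : (0 < n)%N by near: n; exists 1%N.
  have nR : (0 : R) < n%:R by rewrite ltr0n.
  rewrite -(ler_pM2l nR) mulrBr mulr1 mulrCA mulfV ?gt_eqF// mulr1 mulVKf ?gt_eqF//.
  by rewrite lerBlDr -natrD ler_nat.
have /cvgrPdist_lt/(_ (a - (1 + c)^-1)) : n%:R^-1 * (ones (digits x) n)%:R @[n --> \oo] --> a.
  exact: xa.
rewrite subr_gt0 => /(_ ca) [N _ NP].
have [n Nn [n0 sp]] := freq N.
have := NP n Nn; apply/negP; rewrite -leNgt.
have nR : (0 : R) < n%:R by rewrite ltr0n.
have c1 : (0 : R) < 1 + c by rewrite addr_gt0.
have le : n%:R^-1 * (ones (digits x) n)%:R <= (1 + c)^-1.
  by rewrite ler_pdivrMl// ler_pdivlMr// mulrC.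
by rewrite ger0_norm ?lerD2l ?lerN2// subr_ge0 (le_trans le)// ltW.
Unshelve. all: by end_near. Qed.

End Frequency.

Theorem theorem6 (R : realType) (tau : \bar R) (tau_gt0 : (0 < tau)%E) :
  exists (X : pointedMetricType R) (f : X -> X) (M : nat -> R -> nat),
    [/\ is_tds f,
        nonuniform_tau_specification f tau /\ gap_functions f M,
        \forall e \near (0 : R)^'+, gap_ratio M e n @[n --> \oo] --> tau,
        exists (psi : X -> R) (gamma : R),
          [/\ continuous psi, 0 < gamma < 1,
              average_range f psi = `[0, 1]%classic
            & forall a : R, gamma < a < 1 ->
              [/\ level_set f psi a = set0,
                  (0 < constrained_entropy f psi a)%E
                & bowen_entropy f (level_set f psi a) = 0%E]]
      & ~ conditional_variational_principle f].
Proof.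
have [g [g_homo g_cvg [c c0 g_ge]]] := exists_gap tau_gt0.
have c1 : 0 < (1 + c)^-1 < 1.
  by rewrite invr_gt0 invf_lt1 ?addr_gt0// ltrDl c0.
have gap (a : R) : (1 + c)^-1 < a < 1 -> [/\ level_set (shift_map : gapshift R g -> _) is_None a = set0,
    (0 < constrained_entropy (shift_map : gapshift R g -> _) is_None a)%E
  & bowen_entropy (shift_map : gapshift R g -> _) (level_set shift_map is_None a) = 0%E].
  move=> a1; have lvl := level_set_is_None c0 g_ge a1; rewrite lvl.
  split=> //; last exact: bowen_entropy_set0.
  by apply: constrained_entropy_is_None_gt0; move/andP: a1 => [? ->]; lra.
exists (gapshift R g), shift_map, (gap_bound (g := g)); split.
- exact: gapshift_tds.
- by split; [exact: gapshift_tau_specification|exact: gap_functions_gap_bound].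
- by near=> e; exact: cvg_gap_ratio.
- exists is_None, (1 + c)^-1; split=> //; first exact: continuous_is_None.
  exact: average_range_is_None.
- have int01 (a : R) : 0 < a < 1 ->
      (average_range (shift_map : gapshift R g -> _) is_None)° a.
    move=> a01; rewrite average_range_is_None interior_itv_bnd /=.
    by rewrite in_itv.
  have [a a1] : exists a : R, (1 + c)^-1 < a < 1.
    by exists (((1 + c)^-1 + 1) / 2); lra.
  have a01 : 0 < a < 1 by lra.
  (* At any [a] between [(1 + c)^-1] and [1], the principle would equate zero Bowen entropy with a
     positive supremum. *)
  move=> /(_ is_None continuous_is_None) cvp.
  have [_ pos bow] := gap a a1.
  have := cvp (ex_intro _ a (int01 a a01)) a (int01 a a01).
  by rewrite bow => eq0; rewrite -eq0 ltxx in pos.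
Unshelve. all: by end_near. Qed.
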